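(* Let $T$ be a complete first-order theory. If $T$ has $\mathrm{TP}_2$, then some formula $\phi(x,y)$ with $|x|=1$ (i.e. $x$ a single variable) has $\mathrm{TP}_2$.
   Context: We work in a monster model of $T$. A formula $\phi(x,y)$ (with $x,y$ finite tuples of variables) has $\mathrm{TP}_2$ (the tree property of the second kind) if there is an array of tuples $(a_{\alpha,i})_{\alpha,i<\omega}$ such that $\{\phi(x,a_{\alpha,i})\}_{i<\omega}$ is $2$-inconsistent (any two members with distinct indices are jointly inconsistent) for every $\alpha<\omega$, and $\{\phi(x,a_{\alpha,f(\alpha)})\}_{\alpha<\omega}$ is consistent for every $f:\omega\to\omega$. Otherwise $\phi(x,y)$ is $\mathrm{NTP}_2$. The theory $T$ is $\mathrm{NTP}_2$ if every formula is; $T$ has $\mathrm{TP}_2$ if it is not $\mathrm{NTP}_2$, i.e. some formula has $\mathrm{TP}_2$. *)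

(* Defs.v *)
From mathcomp Require Import all_boot.
From mathcomp Require Import boolp classical_sets functions cardinality.

Set Implicit Arguments.
Unset Strict Implicit.
Unset Printing Implicit Defensive.

Local Open Scope classical_set_scope.
Local Open Scope card_scope.

(* One-sorted first-order languages with equality, of arbitrary cardinality. *)
Record language : Type := Language {
  func : Type;
  func_arity : func -> nat;
  rel_sym : Type;
  rel_arity : rel_sym -> nat }.

(* The free variables of a term or formula are drawn from a type V;
   a quantifier binds the variable None of option V. *)
Inductive term (L : language) (V : Type) : Type :=
| Var of V
| App (f : func L) of ('I_(func_arity f) -> term L V).

Inductive formula (L : language) (V : Type) : Type :=
| Equal of term L V & term L V
| Rel (r : rel_sym L) of ('I_(rel_arity r) -> term L V)
| Bot
| Imp of formula L V & formula L V
| All of formula L (option V).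

Arguments Bot {L V}.

Definition sentence (L : language) : Type := formula L void.
Definition Neg (L : language) (V : Type) (phi : formula L V) : formula L V :=
  Imp phi Bot.

Fixpoint rename_term (L : language) (V W : Type) (g : V -> W) (t : term L V)
    : term L W :=
  match t with
  | Var v => Var L (g v)
  | App f ts => App (fun i => rename_term g (ts i))
  end.

Fixpoint rename (L : language) (V W : Type) (g : V -> W) (phi : formula L V)
    : formula L W :=
  match phi with
  | Equal t u => Equal (rename_term g t) (rename_term g u)
  | Rel r ts => Rel (fun i => rename_term g (ts i))
  | Bot => Bot
  | Imp p q => Imp (rename g p) (rename g q)
  | All p => All (rename (omap g) p)
  end.

Record structure (L : language) : Type := Structure {
  carrier :> Type;
  carrier_inhabited : inhabited carrier;
  func_interp : forall f : func L, ('I_(func_arity f) -> carrier) -> carrier;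
  rel_interp : forall r : rel_sym L, ('I_(rel_arity r) -> carrier) -> Prop }.

Fixpoint eval (L : language) (M : structure L) (V : Type) (e : V -> M)
    (t : term L V) : M :=
  match t with
  | Var v => e v
  | App f ts => func_interp (fun i => eval e (ts i))
  end.

Fixpoint sat (L : language) (M : structure L) (V : Type) (e : V -> M)
    (phi : formula L V) : Prop :=
  match phi with
  | Equal t u => eval e t = eval e u
  | Rel r ts => rel_interp (fun i => eval e (ts i))
  | Bot => False
  | Imp p q => sat e p -> sat e q
  | All p => forall a : M, sat (fun o => oapp e a o) p
  end.

Definition holds (L : language) (M : structure L) (s : sentence L) : Prop :=
  sat (of_void M) s.

Definition models (L : language) (T : set (sentence L)) (M : structure L)
    : Prop :=
  forall s, T s -> holds M s.

Definition entails (L : language) (T : set (sentence L)) (s : sentence L)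
    : Prop :=
  forall M : structure L, models T M -> holds M s.

Definition complete_theory (L : language) (T : set (sentence L)) : Prop :=
  (exists M : structure L, models T M) /\
  forall s, entails T s \/ entails T (Neg s).

(* L(M)-formulas in a tuple x of n variables: the constant naming an element
   of M is encoded as an extra free variable, always evaluated at that
   element (see sat_param). *)
Definition pformula (L : language) (M : structure L) (n : nat) : Type :=
  formula L ('I_n + M).

Definition sat_param (L : language) (M : structure L) (n : nat)
    (x : 'I_n -> M) (psi : pformula M n) : Prop :=
  sat (fun v => match v with inl i => x i | inr a => a end) psi.

(* inst phi b is the L(M)-formula phi(x, b). *)
Definition inst (L : language) (M : structure L) (n m : nat)
    (phi : formula L ('I_n + 'I_m)) (b : 'I_m -> M) : pformula M n :=
  rename (fun v => match v with inl i => inl i | inr j => inr (b j) end) phi.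

Definition formulas_over (L : language) (M : structure L) (n : nat)
    (A : set M) : set (pformula M n) :=
  [set psi | exists (m : nat) (phi : formula L ('I_n + 'I_m)) (b : 'I_m -> M),
               (forall j, A (b j)) /\ psi = inst phi b].

(* Consistency with the elementary diagram of M, that is, finite
   satisfiability in M. *)
Definition consistent (L : language) (M : structure L) (n : nat)
    (p : set (pformula M n)) : Prop :=
  forall q : set (pformula M n), q `<=` p -> finite_set q ->
    exists x : 'I_n -> M, forall psi, q psi -> sat_param x psi.

Definition realized (L : language) (M : structure L) (n : nat)
    (p : set (pformula M n)) : Prop :=
  exists x : 'I_n -> M, forall psi, p psi -> sat_param x psi.

(* Cardinals are represented by types: |A| < |K|. *)
Definition smaller (T K : Type) (A : set T) : Prop := ~ ([set: K] #<= A).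

Definition saturated (K : Type) (L : language) (M : structure L) : Prop :=
  forall (A : set M), smaller K A ->
  forall (n : nat) (p : set (pformula M n)),
    p `<=` formulas_over A -> consistent p -> realized p.

Definition elementary_on (L : language) (M : structure L) (A : set M)
    (f : M -> M) : Prop :=
  forall (n : nat) (phi : formula L 'I_n) (a : 'I_n -> M),
    (forall i, A (a i)) -> (sat a phi <-> sat (f \o a) phi).

Definition automorphism (L : language) (M : structure L) (s : M -> M) : Prop :=
  [/\ bijective s,
      forall (f : func L) (a : 'I_(func_arity f) -> M),
        s (func_interp a) = func_interp (s \o a)
    & forall (r : rel_sym L) (a : 'I_(rel_arity r) -> M),
        rel_interp a <-> rel_interp (s \o a)].

Definition strongly_homogeneous (K : Type) (L : language) (M : structure L)
    : Prop :=
  forall (A : set M) (f : M -> M), smaller K A -> elementary_on A f ->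
    exists s : M -> M, automorphism s /\ (forall a, A a -> s a = f a).

(* The only largeness required of kappa = |K| is kappa > |L| + aleph_0. *)
Definition monster_model (L : language) (T : set (sentence L))
    (M : structure L) : Prop :=
  models T M /\
  exists K : Type,
    [/\ smaller K [set: nat + (func L + rel_sym L)],
        saturated K M & strongly_homogeneous K M].

Definition formula_TP2 (L : language) (M : structure L) (n m : nat)
    (phi : formula L ('I_n + 'I_m)) : Prop :=
  exists a : nat -> nat -> 'I_m -> M,
    (forall alpha i j : nat, i <> j ->
       ~ consistent [set inst phi (a alpha i); inst phi (a alpha j)]) /\
    (forall f : nat -> nat,
       consistent [set inst phi (a alpha (f alpha)) | alpha in [set: nat]]).

(* Stated in the monster model M of the theory. *)
Definition theory_TP2 (L : language) (M : structure L) : Prop :=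
  exists (n m : nat) (phi : formula L ('I_n + 'I_m)), formula_TP2 M phi.

(* Main.v *)
Require Import Defs.
From mathcomp Require Import all_boot.
From mathcomp Require Import boolp classical_sets functions cardinality.
From mathcomp Require Import filter zify.

(** Suppose that no formula in one variable has TP2, and let phi(x, y; z), with
x a single variable, have TP2, witnessed by an array a. It is enough to find,
for every K, one element x together with K rows of a and K columns in each of
them such that all the paths through this K by K box are consistent with x,
that is, phi(x, y; z) is satisfiable in y along each of them. The rows of the
box are still 2-inconsistent, so phi(y; x z) then has arbitrarily large finite
TP2 patterns, hence TP2 by compactness (TP2_of_patterns), and y is shorter than
x y (TP2_drop_variable). Iterating this exhausts the variables (no_TP2).

The box is built by enlarging its sides one column at a time. The rows of a are
grouped into cells of K rows. For a shape h, the condition [full h] on x says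
that x is compatible with every path through a box of shape h inside a given
cell. It is a formula in the single variable x, whose parameters are the
entries of the box. For h = 1 arbitrarily many cells can be satisfied together,
since the paths of a are consistent. Suppose that this holds for h, and try to
enlarge h at one coordinate i0 in the cells one after the other (mixedS). If it
becomes impossible after t cells, group the remaining cells into chunks of a
fixed size. In each chunk, enlarging the first cell is inconsistent with the
rest of the configuration. Enlarging means adding to k.+1 columns a
further one, so if the first k columns are put into the parameters and the last
one varies, then each chunk yields a 2-inconsistent row of instances of one
formula in x. The paths through these rows are consistent because the
configuration of shape h is: this is TP2 in one variable, a contradiction.

For this argument the consistency of a configuration must not depend on the
choice of the columns. In place of mutually indiscernible arrays, each column
is treated as a generic element with respect to a fixed free ultrafilter on
nat, generic elements of different columns being taken successively (power,
generic). A property of the generic columns is then either true or false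
(generic_decisive), and a true one is realized by an honest array all of whose
increasing selections have it (generic_extract). *)

Set Implicit Arguments.
Unset Strict Implicit.
Unset Printing Implicit Defensive.

Local Open Scope classical_set_scope.

(** * Definable relations *)

Lemma eval_rename (L : language) (M : structure L) (V W : Type) (g : V -> W)
    (e : W -> M) (t : term L V) :
  eval e (rename_term g t) = eval (e \o g) t.
Proof. by elim: t => //= f ts IH; congr func_interp; apply: funext. Qed.

Lemma sat_rename (L : language) (M : structure L) (V W : Type) (g : V -> W)
    (e : W -> M) (phi : formula L V) :
  sat e (rename g phi) <-> sat (e \o g) phi.
Proof.
elim: phi W g e => {V} /=.
- by move=> V t u W g e; rewrite !eval_rename.
- move=> V r ts W g e.
  by rewrite (_ : (fun i => _) = (fun i => eval (e \o g) (ts i))) //;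
    apply: funext => i; rewrite eval_rename.
- by [].
- by move=> V p IHp q IHq W g e; rewrite IHp IHq.
- move=> V p IH W g e; split=> H a; have := H a; rewrite IH;
    by rewrite (_ : _ \o _ = (fun o => oapp (e \o g) a o)) //;
    apply: funext => -[].
Qed.

Definition sum_env (V W A : Type) (e : V -> A) (f : W -> A) (v : V + W) : A :=
  match v with inl i => e i | inr j => f j end.

Lemma sat_param_inst (L : language) (M : structure L) (n m : nat)
    (phi : formula L ('I_n + 'I_m)) (b : 'I_m -> M) (x : 'I_n -> M) :
  sat_param x (inst phi b) <-> sat (sum_env x b) phi.
Proof.
rewrite /sat_param /inst sat_rename.
by rewrite (_ : _ \o _ = sum_env x b) //; apply: funext => -[].
Qed.

(** Definability without parameters as a property of relations: the formulas
needed below then arise from closure properties, without syntax of their own. *)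
Definition definable (L : language) (M : structure L) (V : Type)
    (E : (V -> M) -> Prop) : Prop :=
  exists phi : formula L V, forall e, sat e phi <-> E e.

Section Definable.
Variables (L : language) (M : structure L).

Lemma definable_ext V (E E' : (V -> M) -> Prop) :
  (forall e, E e <-> E' e) -> definable E -> definable E'.
Proof. by move=> EE' [phi Hphi]; exists phi => e; rewrite Hphi. Qed.

Lemma definable_rename V W (g : V -> W) (E : (V -> M) -> Prop) :
  definable E -> definable (fun e : W -> M => E (e \o g)).
Proof. by move=> [phi Hphi]; exists (rename g phi) => e; rewrite sat_rename. Qed.

Lemma definable_eq V (v w : V) : definable (fun e : V -> M => e v = e w).
Proof. by exists (Equal (Var L v) (Var L w)). Qed.

Lemma definable_imp V (E E' : (V -> M) -> Prop) :
  definable E -> definable E' -> definable (fun e => E e -> E' e).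
Proof.
by move=> [p Hp] [q Hq]; exists (Imp p q) => e /=; rewrite Hp Hq.
Qed.

Lemma definable_const V (P : Prop) : definable (fun _ : V -> M => P).
Proof.
have [HP|nP] := pselect P; first by exists (Imp Bot Bot) => e /=; split.
by exists Bot => e /=; split.
Qed.

Lemma definable_not V (E : (V -> M) -> Prop) :
  definable E -> definable (fun e => ~ E e).
Proof. by move=> dE; apply: definable_imp => //; exact: definable_const. Qed.

Lemma definable_and V (E E' : (V -> M) -> Prop) :
  definable E -> definable E' -> definable (fun e => E e /\ E' e).
Proof.
move=> dE dE'.
apply: (@definable_ext _ (fun e => ~ (E e -> ~ E' e))).
  move=> e; split=> [|[? ?]]; last by apply.
  by move=> /not_implyP[Ee /contrapT].
by apply/definable_not/definable_imp => //; exact: definable_not.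
Qed.

Lemma definable_forall V (F : finType) (E : F -> (V -> M) -> Prop) :
  (forall i, definable (E i)) -> definable (fun e => forall i, E i e).
Proof.
move=> dE.
suff H (s : seq F) : definable (fun e => forall i, i \in s -> E i e).
  apply: definable_ext (H (enum F)) => e; split=> He i; last by move=> _.
  by apply: He; rewrite mem_enum.
elim: s => [|i s IH].
  by apply: definable_ext (definable_const V True) => e; split.
apply: definable_ext (definable_and (dE i) IH) => e; split.
  by move=> [Hi Hs] j; rewrite inE => /orP[/eqP->|/Hs].
by move=> H; split=> [|j js]; apply: H; rewrite inE ?eqxx ?js ?orbT.
Qed.

Lemma definable_exists1 V (E : (option V -> M) -> Prop) :
  definable E -> definable (fun e => exists a, E (fun o => oapp e a o)).
Proof.
move=> dE.
apply: (@definable_ext _ (fun e => ~ forall a, ~ E (fun o => oapp e a o))).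
  by move=> e; split=> [/existsNP[a /contrapT Ea]|[a Ea] /(_ a)] //; exists a.
apply: definable_not.
by have [p Hp] := definable_not dE; exists (All p) => e; split=> He a;
  apply/Hp; exact: He.
Qed.

(** Quantification over a finite tuple, one variable at a time. *)
Lemma definable_exists V (Y : finType) (E : (V + Y -> M) -> Prop) :
  definable E -> definable (fun e => exists y : Y -> M, E (sum_env e y)).
Proof.
move=> dE.
have ord n (E' : (V + 'I_n -> M) -> Prop) : definable E' ->
    definable (fun e => exists y : 'I_n -> M, E' (sum_env e y)).
  elim: n => [|n IH] in E' * => dE'.
    have y0 (A : Type) : 'I_0 -> A by case.
    pose g (v : V + 'I_0) : V := match v with inl v => v | inr i => y0 V i end.
    apply: definable_ext (definable_rename g dE') => e.
    have gE y : e \o g = sum_env e y by apply: funext => -[|[]].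
    by split=> [|[y]]; [exists (y0 M); rewrite -(gE (y0 M))|rewrite (gE y)].
  pose g (v : V + 'I_n.+1) : option (V + 'I_n) :=
    match v with inl v => Some (inl v) | inr i => omap inr (unlift ord0 i) end.
  have dE1 := IH _ (definable_exists1 (definable_rename g dE')).
  apply: definable_ext dE1 => e; split=> [[y [a Ea]]|[y Ey]].
    exists (fun i => oapp y a (unlift ord0 i)).
    rewrite (_ : sum_env _ _ = (fun o => oapp (sum_env e y) a o) \o g) //.
    by apply: funext => -[v//|i] /=; case: (unlift ord0 i).
  exists (y \o lift ord0), (y ord0).
  rewrite (_ : _ \o g = sum_env e y) //.
  by apply: funext => -[v//|i] /=; case: unliftP => [j|] ->.
pose g (v : V + Y) : V + 'I_#|Y| :=
  match v with inl v => inl v | inr i => inr (enum_rank i) end.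
apply: definable_ext (ord _ _ (definable_rename g dE)) => e.
split=> [[y Ey]|[y Ey]].
  exists (y \o enum_rank).
  rewrite (_ : sum_env _ _ = sum_env e y \o g) //.
  by apply: funext => -[].
exists (y \o enum_val); rewrite (_ : _ \o g = sum_env e y) //.
by apply: funext => -[v//|i] /=; rewrite enum_rankK.
Qed.
End Definable.

(** * Countable types in a saturated model *)

Lemma finite_subset_range (T : Type) (F : nat -> T) (q : set T) :
  finite_set q -> q `<=` range F ->
  exists N, forall t, q t -> exists2 k, k < N & t = F k.
Proof.
move=> qfin qF.
have /choice [g gP] : forall t, exists k, q t -> t = F k.
  move=> t; have [qt|nqt] := pselect (q t); last by exists 0.
  by have [k _ <-] := qF _ qt; exists k.
have /finite_seqP[s sE] := finite_image g qfin.
exists (\max_(k <- s) k).+1 => t qt; exists (g t); last exact: gP.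
have : g t \in s by have : [set` s] (g t) by rewrite -sE; exists t.
by move=> gs; rewrite ltnS; apply: leq_bigmax_seq.
Qed.

Section Saturation.
Variables (L : language) (M : structure L) (K : Type).
Hypothesis K_big : smaller K [set: nat + (func L + rel_sym L)].
Hypothesis M_sat : saturated K M.

(** Saturation for one variable over a finite tuple. For a decreasing sequence of
formulas, finite satisfiability is satisfiability of each member. *)
Lemma realize_decreasing (s : nat) (E : nat -> ('I_1 + 'I_s -> M) -> Prop)
    (c : 'I_s -> M) :
  (forall k, definable (E k)) ->
  (forall k x, E k.+1 (sum_env x c) -> E k (sum_env x c)) ->
  (forall k, exists x, E k (sum_env x c)) ->
  exists x, forall k, E k (sum_env x c).
Proof.
move=> /choice[phi phiE] Edec Ex.
have Emon k l x : k <= l -> E l (sum_env x c) -> E k (sum_env x c).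
  move=> /subnK <-; elim: (l - k) => [//|j IH]; rewrite addSn => /Edec; exact: IH.
have Asmall : smaller K (range c).
  move=> KA; apply: K_big; apply: card_le_trans KA _.
  apply: (@card_le_trans _ _ _ [set: nat]).
    by apply: finite_set_countable; apply: finite_image; exact: finite_finset.
  have : ((@inl nat (func L + rel_sym L)) @` [set: nat] #= [set: nat])%card.
    by apply: (@inj_card_eq _ (nat + (func L + rel_sym L))) => ? ? _ _ [].
  move=> /card_eqPle[_ H]; exact: card_le_trans H (card_leT _).
have [x xP] : realized (range (fun k => inst (phi k) c)).
  apply: (M_sat Asmall).
    by move=> _ [k _ <-]; exists s, (phi k), c; split=> // j; exists j.
  move=> q qp /finite_subset_range /(_ qp)[N qN].
  have [x ENx] := Ex N; exists x => psi /qN[k kN ->].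
  by rewrite sat_param_inst phiE; apply: Emon ENx; apply: ltnW.
exists x => k; apply/phiE/sat_param_inst; apply: xP; by exists k.
Qed.

(** A sequence of conditions, each on finitely many of countably many variables,
is realized by choosing the variables in turn so that every condition remains
satisfiable by an extension of the values already chosen. *)
Lemma realize_countable (N : nat -> nat) (E : forall k, ('I_(N k) -> M) -> Prop) :
  (forall k, definable (@E k)) ->
  (forall k (e : nat -> M), E k.+1 (fun i => e i) -> E k (fun i => e i)) ->
  (forall k, exists e : nat -> M, E k (fun i => e i)) ->
  exists e : nat -> M, forall k, E k (fun i => e i).
Proof.
move=> dE Edec Ex.
pose good s (c : nat -> M) := forall k,
  exists e : nat -> M, (forall i, i < s -> e i = c i) /\ E k (fun i => e i).
have step s c : good s c ->
    exists a, good s.+1 (fun i => if i == s then a else c i).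
  move=> gsc.
  pose F k (e : 'I_1 + 'I_s -> M) := exists y : 'I_(N k) -> M,
    [/\ forall i (j : 'I_s), val i = val j -> y i = e (inr j),
        forall i, val i = s -> y i = e (inl ord0)
      & E k y].
  have FP k x : F k (sum_env x (fun j : 'I_s => c j)) <->
    exists e : nat -> M, [/\ forall i, i < s -> e i = c i, e s = x ord0
      & E k (fun i => e i)].
    split=> [[y [y1 y2 Ey]]|[e [e1 e2 Ee]]]; last first.
      exists (fun i => e i); split=> // [i j /= ->|i ->//].
      exact: e1.
    exists (fun i => if insub i is Some j then y j else
                     if i < s then c i else x ord0); split.
    - move=> i lis; case: insubP => [j _ ji|_]; last by rewrite lis.
      exact: (y1 j (Ordinal lis)).
    - case: insubP => [j _ /y2//|_]; by rewrite ltnn.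
    - rewrite (_ : (fun i => _) = y) //; apply: funext => i; by rewrite valK.
  have [x xP] : exists x, forall k, F k (sum_env x (fun j : 'I_s => c j)).
    apply: realize_decreasing.
    - move=> k; pose V := (('I_1 + 'I_s) + 'I_(N k))%type.
      have dF : @definable L M V (fun w => [/\ forall i (j : 'I_s),
          val i = val j -> w (inr i) = w (inl (inr j)),
          forall i, val i = s -> w (inr i) = w (inl (inl ord0))
        & E k (w \o inr)]).
        apply: (@definable_ext _ _ _ (fun w : V -> M => (forall i (j : 'I_s),
            val i = val j -> w (inr i) = w (inl (inr j))) /\
            (forall i, val i = s -> w (inr i) = w (inl (inl ord0))) /\
            E k (w \o inr))); first by move=> w; split=> [[? []]|[]].
        apply: definable_and; last apply: definable_and.
        + apply: definable_forall => i; apply: definable_forall => j.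
          by apply: definable_imp (definable_eq _ _ _); exact: definable_const.
        + apply: definable_forall => i.
          by apply: definable_imp (definable_eq _ _ _); exact: definable_const.
        + exact: definable_rename.
      apply: definable_ext (definable_exists dF) => e.
      by split=> -[y [y1 y2 Ey]]; exists y.
    - move=> k x /FP[e [e1 e2 /Edec Ee]]; apply/FP; by exists e.
    - move=> k; have [e [ec Ee]] := gsc k.
      by exists (fun=> e s); apply/FP; exists e.
  exists (x ord0) => k; have /FP[e [e1 e2 Ee]] := xP k.
  exists e; split=> // i; rewrite ltnS leq_eqVlt; case: eqP => [->//|_ /e1//].
have good0 : exists c, good 0 c.
  by have [c _] := Ex 0; exists c => k; have [e Ee] := Ex k; exists e.
have [c0 gc0] := good0.
have /choice[a aP] : forall sc : nat * (nat -> M), exists a, good sc.1 sc.2 ->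
    good sc.1.+1 (fun i => if i == sc.1 then a else sc.2 i).
  move=> [s c] /=; have [gsc|?] := pselect (good s c); last by exists (c 0).
  by have [a ga] := step _ _ gsc; exists a.
pose C := fix C s := if s is s'.+1 then
  (fun i => if i == s' then a (s', C s') else C s' i) else c0.
have gC s : good s (C s) by elim: s => //= s /(aP (s, C s)).
have CE s i : i < s -> C s i = C i.+1 i.
  elim: s => //= s IH; rewrite ltnS leq_eqVlt; case: eqP => [->|_ /IH//].
  by rewrite eqxx.
exists (fun i => C i.+1 i) => k; have [e [eC Ee]] := gC (N k) k.
rewrite (_ : (fun i => _) = (fun i : 'I_(N k) => e i)) //.
by apply: funext => i; rewrite eC // CE.
Qed.
End Saturation.

(** * Finite patterns *)

(** A finite R by R piece of a TP2 array, for a relation in place of a formula. *)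
Definition pattern (M X I : Type) (E : (X -> M) -> (I -> M) -> Prop) (R : nat)
    (a : 'I_R -> 'I_R -> I -> M) : Prop :=
  (forall alpha i j : 'I_R, i < j ->
     ~ exists x, E x (a alpha i) /\ E x (a alpha j)) /\
  (forall f : {ffun 'I_R -> 'I_R}, exists x, forall alpha, E x (a alpha (f alpha))).

Lemma patternS (M X I : Type) (E : (X -> M) -> (I -> M) -> Prop) (R : nat)
    (a : nat -> nat -> I -> M) :
  pattern E (fun alpha i : 'I_R.+1 => a alpha i) ->
  pattern E (fun alpha i : 'I_R => a alpha i).
Proof.
move=> [incons cons]; split=> [alpha i j ij|f].
  exact: (incons (widen_ord (leqnSn R) alpha) (widen_ord (leqnSn R) i)
                 (widen_ord (leqnSn R) j)).
have [x xP] := cons [ffun alpha => if insub (val alpha) is Some beta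
                                   then widen_ord (leqnSn R) (f beta) else ord0].
exists x => alpha; have := xP (widen_ord (leqnSn R) alpha).
by rewrite ffunE /= valK.
Qed.

Definition definable_rel (L : language) (M : structure L) (X I : Type)
    (E : (X -> M) -> (I -> M) -> Prop) : Prop :=
  definable (fun e : X + I -> M => E (e \o inl) (e \o inr)).

Lemma definable_pattern (L : language) (M : structure L) (X I : finType)
    (E : (X -> M) -> (I -> M) -> Prop) (R : nat) :
  definable_rel E ->
  definable (fun e : 'I_R * 'I_R * I -> M =>
    pattern E (fun alpha i k => e (alpha, i, k))).
Proof.
move=> dE; pose V := ('I_R * 'I_R * I)%type.
have dEr alpha i : definable (fun e : V + X -> M =>
    E (e \o inr) (fun k => e (inl (alpha, i, k)))).
  exact: (definable_rename (fun v : X + I => match v with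
    inl x => inr x | inr k => inl (alpha, i, k) end) dE).
apply: definable_and.
  apply: definable_forall => alpha; apply: definable_forall => i.
  apply: definable_forall => j; apply: definable_imp.
    exact: definable_const.
  apply: definable_not.
  apply: definable_ext (definable_exists (definable_and (dEr alpha i) (dEr alpha j))).
  by [].
apply: definable_forall => f.
apply: definable_ext (definable_exists (definable_forall
  (fun alpha => dEr alpha (f alpha)))).
by [].
Qed.

Section Compactness.
Variables (L : language) (M : structure L) (K : Type).
Hypothesis K_big : smaller K [set: nat + (func L + rel_sym L)].
Hypothesis M_sat : saturated K M.

(** The entries of an infinite array form a countable family of variables, and
being a pattern on the first R.+1 rows and columns is a condition on finitely
many of them, weaker for smaller R. *)
Lemma TP2_of_patterns (n : nat) (I : finType)
    (E : ('I_n -> M) -> (I -> M) -> Prop) :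
  definable_rel E -> (forall R, exists a : 'I_R -> 'I_R -> I -> M, pattern E a) ->
  exists (m : nat) (phi : formula L ('I_n + 'I_m)), formula_TP2 M phi.
Proof.
move=> dE Epat.
pose code (alpha i : nat) (k : I) := pickle (alpha, i, k).
pose N R := (\max_(v : 'I_R.+1 * 'I_R.+1 * I) code v.1.1 v.1.2 v.2).+1.
have codeN R (alpha i : 'I_R.+1) k : code alpha i k < N R.
  by rewrite ltnS (@leq_bigmax _ (fun v : 'I_R.+1 * 'I_R.+1 * I =>
    code v.1.1 v.1.2 v.2) (alpha, i, k)).
pose F R (e : 'I_(N R) -> M) :=
  pattern E (fun (alpha i : 'I_R.+1) k => e (inord (code alpha i k))).
have FE R (e : nat -> M) : F R (fun i => e i) <->
    pattern E (fun (alpha i : 'I_R.+1) k => e (code alpha i k)).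
  rewrite /F (_ : (fun (alpha i : 'I_R.+1) k => _) =
    (fun (alpha i : 'I_R.+1) k => e (code alpha i k))) //.
  by do 3!apply: funext => ?; rewrite inordK ?codeN.
have [e eP] : exists e : nat -> M, forall R, F R (fun i => e i).
  apply: (realize_countable K_big M_sat).
  - move=> R; have := definable_rename (fun v : 'I_R.+1 * 'I_R.+1 * I =>
      inord (code v.1.1 v.1.2 v.2) : 'I_(N R)) (definable_pattern R.+1 dE).
    by apply: definable_ext => e.
  - move=> R e /FE pat; apply: (FE _ _).2.
    exact: (patternS (a := fun al i k => e (code al i k))).
  - move=> R; have [a aP] := Epat R.+1; have [d] := carrier_inhabited M.
    pose e v := if unpickle v is Some (alpha, i, k)
                then a (inord alpha) (inord i) k else d.
    exists e; apply: (FE R e).2; rewrite (_ : (fun (alpha i : 'I_R.+1) k => _) = a) //.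
    by do 3!apply: funext => ?; rewrite /e pickleK !inord_val.
have {}eP R := (FE R e).1 (eP R).
have [phi phiE] := definable_rename (fun v : 'I_n + I => match v with
  inl i => inl i | inr k => inr (enum_rank k) end) dE.
exists #|I|, phi; pose a alpha i (j : 'I_#|I|) := e (code alpha i (enum_val j)).
have aE x alpha i : sat_param x (inst phi (a alpha i)) <->
    E x (fun k => e (code alpha i k)).
  rewrite sat_param_inst phiE.
  rewrite (_ : (fun k => _) = (sum_env x (a alpha i) \o (fun v : 'I_n + I =>
    match v with inl i => inl i | inr k => inr (enum_rank k) end)) \o inr) //.
  by apply: funext => k; rewrite /= /a enum_rankK.
exists a; split=> [alpha i j|f].
  wlog ij : i j / i < j => [H ij|_ cons].
    have [lt|lt|//] := ltngtP i j; first exact: H.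
    by rewrite setUC; apply: H => // ji; apply: ij.
  have [|x xP] := cons _ (@subset_refl _ _) ; first exact: finite_set2.
  have [ltR ltj lti] : [/\ alpha < (alpha + j).+1, j < (alpha + j).+1
      & i < (alpha + j).+1].
    by rewrite !ltnS leq_addr leq_addl (leq_trans (ltnW ij)) ?leq_addl.
  apply: ((eP (alpha + j)).1 (Ordinal ltR) (Ordinal lti) (Ordinal ltj) ij).
  by exists x; split; apply/aE/xP; [left|right].
move=> q qf /finite_subset_range /(_ qf)[N' qN].
pose R := N' + \max_(k < N') f k.
have [x xP] := (eP R).2 [ffun alpha : 'I_R.+1 => inord (f alpha)].
exists x => psi /qN[k kN ->]; apply/aE.
have kR : k < R.+1 by rewrite ltnS ltnW // (leq_trans kN) ?leq_addr.
have := xP (Ordinal kR); rewrite ffunE inordK //= ltnS.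
by apply: leq_trans (leq_addl _ _); apply: (leq_bigmax (Ordinal kN)).
Qed.
End Compactness.

(** * Iterated ultrafilter quantifiers *)

(** The property that makes a proper filter an ultrafilter, in a form that passes
to iterated quantifiers by induction. *)
Definition decisive (T : Type) (F : set_system T) : Prop :=
  forall A : set T, F A \/ F (~` A).

(** The iterated quantifier: for F-most x_1, for F-most x_2, and so on, the
sequence of the k values chosen is in A. *)
Fixpoint power (T : Type) (F : set_system T) (k : nat) : set_system (seq T) :=
  if k is k'.+1 then [set A | F [set x | power F k' [set s | A (x :: s)]]]
  else [set A | A [::]].

Lemma power_filter T (F : set_system T) k : Filter F -> Filter (power F k).
Proof.
move=> FF; elim: k => [|k IH]; first by split=> //= P Q PQ /PQ.
split=> /=.
- by apply: (@filterE _ _ FF) => x; exact: (@filterT _ _ IH).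
- by move=> P Q; apply: (filterS2 FF) => x; apply: (filterS2 IH) => s; split.
- by move=> P Q PQ; apply: (@filterS _ _ FF) => x; apply: (@filterS _ _ IH) => s;
    exact: PQ.
Qed.

Lemma power_decisive T (F : set_system T) k :
  Filter F -> decisive F -> decisive (power F k).
Proof.
move=> FF Fd; elim: k => [|k IH] A /=.
  by have [?|?] := pselect (A [::]); [left|right].
have [FA|FnA] := Fd [set x | power F k [set s | A (x :: s)]]; first by left.
by right; apply: filterS FnA => x; case: (IH [set s | A (x :: s)]).
Qed.

Lemma power_size T (F : set_system T) k :
  Filter F -> power F k [set s | size s = k].
Proof.
move=> FF; elim: k => //= k IH; apply: filterE => x.
by have := power_filter k FF => ?; apply: filterS IH => s /= ->.
Qed.

Lemma power_all T (F : set_system T) k (p : pred T) :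
  Filter F -> F [set x | p x] -> power F k [set s | all p s].
Proof.
move=> FF Fp; elim: k => //= k IH; apply: filterS Fp => x px.
by have := power_filter k FF => ?; apply: filterS IH => s /= ->; rewrite px.
Qed.

(** A property of generic k-sequences has homogeneous sequences. The first entry x
of b is chosen so that, for every j < k, starting a generic sequence of length
j.+1 with x does not spoil the property; the induction hypothesis is then applied
to the conjunction of the property of s and that of x :: s. This is why
subsequences of all sizes up to k are considered in the induction. *)
Lemma power_homogeneous (T : eqType) (F : set_system T) (k n : nat)
    (A : set (seq T)) :
  ProperFilter F -> (forall x, F [set y | y != x]) -> 0 < k -> power F k A ->
  exists b, [/\ size b = n, uniq b
    & forall s, subseq s b -> size s = k -> A s].
Proof.
move=> FF Fne k0 FA.
pose Q s := size s = k -> A s.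
have Fpow j : Filter (power F j) by exact: power_filter.
suff [b [bn bu bQ]] : exists b, [/\ size b = n, uniq b
    & forall s, subseq s b -> size s <= k -> Q s].
  by exists b; split=> // s sb sk; apply: (bQ s) => //; rewrite sk.
have : forall j, j <= k -> power F j [set s | Q s].
  move=> j; rewrite leq_eqVlt => /orP[/eqP->|jk].
    by apply: filterS FA => s As _.
  by apply: filterS (power_size j _) => s /= sj sk; rewrite -sj sk ltnn in jk.
elim: n Q {FA} => [|n IH] Q FQ.
  exists [::]; split=> // s; rewrite subseq0 => /eqP-> _; exact: (FQ 0).
have [x xP] : exists x, forall j : 'I_k, power F j [set s | Q (x :: s)].
  by apply: (@filter_ex _ F FF); apply: filter_forall => j; exact: (FQ j.+1).
have [|b [bn bu bQ]] := IH (fun s => [/\ Q s, size s < k -> Q (x :: s)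
    & all [pred y | y != x] s]).
  move=> j jk; apply: filterS3 (FQ j jk) _ (power_all j _ (Fne x)).
    by move=> s Qs Qxs xs; split; [exact: Qs|exact: Qxs|exact: xs].
  have := jk; rewrite leq_eqVlt => /orP[/eqP->|ltjk].
    by apply: filterS (power_size k _) => s /= ->; rewrite ltnn.
  by apply: filterS (xP (Ordinal ltjk)) => s /=.
exists (x :: b); split; rewrite /= ?bn ?bu ?andbT //.
  apply/negP => xb; have [||_ _] := bQ [:: x].
  - by rewrite sub1seq.
  - exact: k0.
  - by rewrite /= eqxx.
move=> [|y s]; first by move=> _ _; exact: (FQ 0).
rewrite /=; case: eqP => [->|_] sb sk.
  by have [_ + _] := bQ s sb (ltnW sk); apply.
by have [] := bQ _ sb sk.
Qed.

Lemma subseq_of_increasing (e : nat -> nat) (K n : nat) :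
  (forall s s', s < s' < K -> e s < e s') -> (forall s, s < K -> e s < n) ->
  subseq (map e (iota 0 K)) (iota 0 n).
Proof.
move=> einc en; set l := map e _.
suff -> : l = [seq j <- iota 0 n | j \in l] by exact: filter_subseq.
apply: (irr_sorted_eq ltn_trans ltnn).
- apply: (@homo_sorted_in _ _ (gtn K) e ltn ltn) (iota_ltn_sorted 0 K).
    by move=> s s' _ s'K ss'; apply: einc; apply/andP; split.
  by apply/allP => s; rewrite mem_iota.
- exact: (sorted_filter ltn_trans) (iota_ltn_sorted 0 n).
- move=> j; rewrite mem_filter mem_iota /= add0n.
  apply/idP/andP => [jl|[]//]; split=> //.
  by have /mapP[s] := jl; rewrite mem_iota => sK ->; exact: en.
Qed.

(** A point is a sequence of rows, each a sequence of K generic columns. *)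
Section Generic.
Variables (U : set_system nat) (K : nat).
Hypotheses (U_proper : ProperFilter U) (U_decisive : decisive U)
  (U_free : forall x, U [set y | y != x]) (K0 : 0 < K).

(** The first row is extracted by power_homogeneous. Its K-subsequences are
finitely many, so that their properties can be imposed together on the other
rows. *)
Lemma grid_homogeneous n m (A : set (seq (seq nat))) :
  power (power U K) m A ->
  exists bs : seq (seq nat), [/\ size bs = m,
    forall r, r < m -> size (nth [::] bs r) = n /\ uniq (nth [::] bs r)
  & forall g, size g = m ->
      (forall r, r < m -> subseq (nth [::] g r) (nth [::] bs r) /\
         size (nth [::] g r) = K) -> A g].
Proof.
have UK : Filter (power U K) by exact: power_filter.
elim: m A => [|m IH] A /=.
  by exists [::]; split=> // g /size0nil->.
move=> /(power_homogeneous n U_proper U_free K0)[b [bn bu bA]].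
have [|bs [bsm bsn bsA]] := IH [set g | forall t : n.-tuple bool,
    size (mask t b) = K -> A (mask t b :: g)].
  have Um : Filter (power (power U K) m) by exact: power_filter.
  apply: filter_forall => t; apply: filter_imply => tK; apply: bA => //.
  exact: mask_subseq.
exists (b :: bs); split; rewrite /= ?bsm //; first by case=> [//|r] /bsn.
move=> [//|s g] /= [gm] sP.
have [/subseqP[t tn st] sK] := sP 0 isT; rewrite /= in st sK.
have tn' : size t == n by rewrite tn bn.
rewrite st; apply: (bsA g gm _ (Tuple tn')); first by move=> r /(sP r.+1).
by rewrite /= -st.
Qed.

(** The number m of rows is itself generic, which gives one filter for all the
properties that depend on finitely many rows. *)
Definition generic : set_system (seq (seq nat)) :=
  [set A | U [set m | power (power U K) m A]].

Definition column (g : seq (seq nat)) (r s : nat) : nat := nth 0 (nth [::] g r) s.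

Lemma generic_filter : Filter generic.
Proof.
have Um m : Filter (power (power U K) m) by do 2!apply: power_filter.
have FU : Filter U by exact: filter_filter.
split; rewrite /generic /=.
- by apply: (@filterE _ _ FU) => m; exact: (@filterT _ _ (Um m)).
- by move=> P Q; apply: (filterS2 FU) => m; exact: (@filterI _ _ (Um m)).
- by move=> P Q PQ; apply: (@filterS _ _ FU) => m; apply: (@filterS _ _ (Um m)).
Qed.

Lemma generic_decisive : decisive generic.
Proof.
move=> A; have [|UnA] := U_decisive [set m | power (power U K) m A]; first by left.
right; apply: filterS UnA => m.
have FK : Filter (power U K) by exact: power_filter.
by case: (power_decisive m FK (power_decisive K _ U_decisive) A).
Qed.

(** Here e r lists the K columns selected in row r of the extracted array b. *)
Lemma generic_extract (A : set (seq (seq nat))) (m0 n : nat) :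
  generic A ->
  exists b : nat -> nat -> nat,
    (forall r, r < m0 -> {in gtn n &, injective (b r)}) /\
    forall e : nat -> nat -> nat,
      (forall r s s', s < s' < K -> e r s < e r s') ->
      (forall r s, s < K -> e r s < n) ->
      exists2 g, A g & forall r s, r < m0 -> s < K -> column g r s = b r (e r s).
Proof.
move=> gA.
have [m [m0m]] : exists m, m0 <= m /\ power (power U K) m A.
  apply: (@filter_ex _ U U_proper); apply: filterI => //.
  suff /filterS : U [set m | forall i : 'I_m0, m != val i].
    apply=> m mP; rewrite leqNgt; apply/negP => mm0.
    by have := mP (Ordinal mm0); rewrite eqxx.
  by apply: filter_forall => i; exact: U_free.
move=> /(grid_homogeneous n)[bs [bsm bsn bsA]].
exists (fun r => nth 0 (nth [::] bs r)); split.
  move=> r rm0 i j; rewrite !inE => iltn jltn.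
  have [bn bu] := bsn r (leq_trans rm0 m0m).
  by move=> /eqP; rewrite nth_uniq ?bn // => /eqP.
move=> e einc en.
exists (mkseq (fun r => mkseq (fun s => nth 0 (nth [::] bs r) (e r s)) K) m); last first.
  by move=> r s rm0 sK; rewrite /column !nth_mkseq ?(leq_trans rm0).
apply: bsA => [|r rm]; first by rewrite size_mkseq.
 rewrite nth_mkseq // size_mkseq; split=> //.
have [bn _] := bsn r rm.
rewrite -[X in subseq _ X](mkseq_nth 0) /mkseq bn.
rewrite (map_comp (nth 0 (nth [::] bs r)) (e r)); apply: map_subseq.
by apply: subseq_of_increasing => [s s'|s]; [exact: einc|exact: en].
Qed.
End Generic.

Lemma free_ultrafilter : exists U : set_system nat,
  [/\ ProperFilter U, decisive U & forall x, U [set y | y != x]].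
Proof.
have [U [UU oU]] := @ultraFilterLemma _ eventually _.
exists U; split=> [|A|x]; first exact: ultra_proper.
  exact: in_ultra_setVsetC.
by apply: oU; exists x.+1 => // y /= xy; rewrite gtn_eqF.
Qed.

(** * Enlarging the boxes *)

Section Core.
Variables (L : language) (M : structure L) (Y Z : finType).
Variable Phi : ('I_1 -> M) -> (Y -> M) -> (Z -> M) -> Prop.
Hypothesis Phi_definable : definable (fun e : ('I_1 + Z) + Y -> M =>
  Phi (e \o inl \o inl) (e \o inr) (e \o inl \o inr)).
Variable a : nat -> nat -> Z -> M.
Hypothesis a_paths : forall (f : nat -> nat) (D : nat),
  exists x y, forall alpha, alpha < D -> Phi x y (a alpha (f alpha)).
Hypothesis no_pattern1 : forall (I : finType) (E : ('I_1 -> M) -> (I -> M) -> Prop),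
  definable_rel E -> exists R, forall w : 'I_R -> 'I_R -> I -> M, ~ pattern E w.
Variables (U : set_system nat) (K : nat).
Hypotheses (U_proper : ProperFilter U) (U_decisive : decisive U)
  (U_free : forall x, U [set y | y != x]) (K_gt0 : 0 < K).

Let gen := generic U K.

(** Row i of cell beta, in any numbering that keeps distinct rows apart. *)
Definition row (beta : nat) (i : 'I_K) : nat := pickle (beta, i).

(** The element x is compatible with all the paths through the box given by the
first h i entries of each row i of c. *)
Definition full (h : 'I_K -> nat) (x : 'I_1 -> M) (c : 'I_K -> 'I_K -> Z -> M) :=
  forall f : {ffun 'I_K -> 'I_K}, (forall i, f i < h i) ->
  exists y, forall i, Phi x y (c i (f i)).

Definition cell (g : seq (seq nat)) (beta : nat) (i s : 'I_K) : Z -> M :=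
  a (row beta i) (column g (row beta i) s).

(** Arbitrarily many cells can be satisfied together, with generic columns and
shape h. *)
Definition level (h : 'I_K -> nat) : Prop := forall R,
  exists sigma : nat -> nat, injective sigma /\
    gen [set g | exists x, forall q, q < R -> full h x (cell g (sigma q))].

Definition bump (i0 : 'I_K) (h : 'I_K -> nat) (i : 'I_K) : nat := h i + (i == i0).

(** Among t + d cells satisfied together, the first t already have the enlarged
shape. *)
Definition mixed (i0 : 'I_K) h (t d : nat) (sigma : nat -> nat) : Prop :=
  gen [set g | exists x, forall q, q < t + d ->
    full (if q < t then bump i0 h else h) x (cell g (sigma q))].

Lemma row_inj beta beta' i i' : row beta i = row beta' i' -> beta = beta' /\ i = i'.
Proof. by move=> /(pcan_inj pickleK)[-> ->]. Qed.

Lemma definable_full (Q : finType) (h : Q -> 'I_K -> nat) :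
  definable_rel (fun (x : 'I_1 -> M) (w : Q * 'I_K * 'I_K * Z -> M) =>
    forall q, full (h q) x (fun i s z => w (q, i, s, z))).
Proof.
apply: definable_forall => q; apply: definable_forall => f.
apply: definable_imp; first exact: definable_const.
pose V := ('I_1 + Q * 'I_K * 'I_K * Z)%type.
pose g i (v : ('I_1 + Z) + Y) : V + Y := match v with
  | inl (inl o) => inl (inl o) | inl (inr z) => inl (inr (q, i, f i, z))
  | inr y => inr y end.
exact: (definable_exists (definable_forall
  (fun i => definable_rename (g i) Phi_definable))).
Qed.

(** If no configuration has t.+1 enlarged cells and d others, a configuration with
t enlarged cells and R * d.+1 others gives an R by R pattern for a relation in one
variable: chunk i consists of the t enlarged cells and of d.+1 others (tau i),
and the pattern varies the last of the h i0 columns in row i0 of cell t of the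
chunk. *)
Lemma mixedS (i0 : 'I_K) h t : 0 < h i0 < K ->
  (forall d, exists sigma, injective sigma /\ mixed i0 h t d sigma) ->
  forall d, exists sigma, injective sigma /\ mixed i0 h t.+1 d sigma.
Proof.
move=> /andP[h0 hK] mix d; apply: contrapT => nomix.
pose Q := 'I_(t + d.+1).
have [R noR] := no_pattern1 (definable_full
  (fun q : Q => if q < t then bump i0 h else h)).
have [sigma [sigma_inj gen1]] := mix (R * d.+1).
pose tau i q := sigma (if q < t then q else q + i * d.+1).
have tau_inj i i' q : q < t + d.+1 -> tau i q = tau i' t -> q = t /\ i = i'.
  move=> qlt /sigma_inj; rewrite ltnn; case: ltnP => [qt qE|tq].
    by move: qt; rewrite qE ltnNge leq_addr.
  rewrite -(subnKC tq) -addnA => /eqP; rewrite eqn_add2l => /eqP qE.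
  have qd : q - t < d.+1 by rewrite ltn_subLR.
  have iE : i = i'.
    have := congr1 (divn^~ d.+1) qE.
    by rewrite /= addnC divnMDl // divn_small // addn0 mulnK.
  split=> //; move: qE; rewrite -iE => /(canRL (addnK _)).
  by rewrite subnn => ->; rewrite addn0.
have gF : Filter gen by exact: generic_filter.
(* In each chunk, its cell number t cannot be enlarged as well. *)
have gen2 (i : 'I_R) : gen [set g | ~ exists x, forall q, q < t.+1 + d ->
    full (if q < t.+1 then bump i0 h else h) x (cell g (tau i q))].
  have [good|//] := generic_decisive K U_proper U_decisive [set g | exists x,
    forall q, q < t.+1 + d ->
    full (if q < t.+1 then bump i0 h else h) x (cell g (tau i q))].
  exfalso; apply: nomix; exists (tau i); split=> // q q' /sigma_inj.
  have [qt|tq] := ltnP q t; have [q't|tq'] := ltnP q' t => //.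
  - by move=> qE; move: qt; rewrite qE ltnNge (leq_trans tq') ?leq_addr.
  - by move=> qE; move: q't; rewrite -qE ltnNge (leq_trans tq) ?leq_addr.
  - by move/eqP; rewrite eqn_add2r => /eqP.
pose m0 := (\max_(v : 'I_R * Q * 'I_K) row (tau v.1.1 v.1.2) v.2).+1.
have row_m0 (i : 'I_R) (q : Q) (i' : 'I_K) : row (tau i q) i' < m0.
  by rewrite ltnS (@leq_bigmax _ (fun v : 'I_R * Q * 'I_K =>
    row (tau v.1.1 v.1.2) v.2) (i, q, i')).
have [b [_ bP]] := generic_extract U_proper U_free K_gt0 m0 (K + R)
  (filterI gen1 (filter_forall _ gen2)).
(* The row star i varies: its first k columns are fixed, and the column k is
shifted by j, which needs at most R columns beyond the K of the box. *)
pose k := (h i0).-1; have kh : k.+1 = h i0 by rewrite prednK.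
pose star i := row (tau i t) i0.
pose shift j s := if s < k then s else s + j.
pose w i j (v : Q * 'I_K * 'I_K * Z) := let: (q, i', s, z) := v in
  let r := row (tau i q) i' in
  a r (b r (if r == star i then shift j s else s)) z.
apply: (noR (fun i j => w i j)); split=> [i j j' jj'|f].
  (* Instances j and j' use the columns k + j and k + j' in place of column k; if
  x satisfied both, it would satisfy the enlarged box having these two as its
  columns k and k.+1. *)
  pose e r s := if r == star i then
    (if s < k then s else if s == k then k + j else s.-1 + j') else s.
  have [||g [_ /(_ i)bad] gE] := bP e.
  - by move=> r s s'; rewrite /e; case: ifP => _; repeat case: ifP; lia.
  - move=> r s sK; have := ltn_ord j; have := ltn_ord j'.
    by rewrite /e; case: ifP => _; repeat case: ifP; lia.
  move=> [x [x1 x2]]; apply: bad; exists x => q; rewrite addSnnS => qlt f f_lt.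
  have qi0 i' : (row (tau i q) i' == star i) = (q == t) && (i' == i0).
    apply/eqP/andP => [/row_inj[/(tau_inj _ _ _ qlt)[-> _] ->]|[/eqP-> /eqP->]] //.
  have cE i' (s : 'I_K) : cell g (tau i q) i' s =
      a (row (tau i q) i') (b (row (tau i q) i') (e (row (tau i q) i') s)).
    by rewrite /cell gE // (row_m0 i (Ordinal qlt)).
  (* A path using column k.+1 of the enlarged row is handled by instance j', all
  the others by instance j. *)
  have [/andP[/eqP qt /eqP fk]|nfk] := boolP ((q == t) && (f i0 == k.+1 :> nat)).
    have kK : k < K by rewrite kh ltnW.
    pose f' := [ffun i' => if i' == i0 then Ordinal kK else f i'].
    have [|y yP] := x2 (Ordinal qlt) f'.
      move=> i'; rewrite /= qt ltnn ffunE.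
      have := f_lt i'; rewrite qt ltnSn /bump.
      by case: eqP => [->|_]; rewrite ?addn0 //= kh.
    exists y => i'; rewrite cE; have := yP i'; rewrite /w /e ffunE /= qi0 qt eqxx /=.
    case: eqP => [->|//] /=; rewrite /shift ltnn fk ltnNge leqnSn /=.
    by rewrite gtn_eqF.
  have [|y yP] := x1 (Ordinal qlt) f.
    move=> i' /=; have := f_lt i'; move: nfk; rewrite ltnS.
    case: (ltngtP q t) => [_|_|_] /= nf //; move: nf.
    rewrite /bump; case: (i' =P i0) => [->|_]; last by rewrite /= addn0.
    by rewrite kh; lia.
  exists y => i'; rewrite cE; have := yP i'; rewrite /w /e /= qi0.
  case: (q =P t) nfk => //= qt nfk; case: (i' =P i0) => //= i'i0.
  rewrite /shift; case: (ltngtP (f i') k) => // [kf|->//].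
  have := f_lt i'; rewrite qt ltnSn /bump i'i0 eqxx -kh addn1 ltnS => fk.
  by move: nfk kf; rewrite i'i0; lia.
(* The chunks vary different rows, so that a path of the pattern is one selection
of columns. *)
pose e r s := if [pick i | r == star (val i)] is Some i then shift (f i) s else s.
have eE (i : 'I_R) (q : Q) i' s : e (row (tau i q) i') s =
    if row (tau i q) i' == star i then shift (f i) s else s.
  rewrite /e; case: pickP => [i1 /eqP /row_inj[tE ->]|/(_ i)-> //].
  have [qt ii1] := tau_inj _ _ _ (ltn_ord q) tE.
  by rewrite (val_inj ii1 : i = i1) /star qt eqxx.
have [||g [[x xP] _] gE] := bP e.
- move=> r s s'; rewrite /e; case: pickP => [i _|_]; rewrite /shift; last by lia.
  by repeat case: ifP; lia.
- move=> r s sK; rewrite /e; case: pickP => [i _|_]; rewrite /shift; last by lia.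
  by have := ltn_ord (f i); repeat case: ifP; lia.
exists x => i q f' f'_lt.
have [||y yP] := xP (if q < t then q : nat else q + i * d.+1) _ f'.
- case: ifP => [qt|_]; first by rewrite ltn_addr.
  have : q + i * d.+1 < t + i.+1 * d.+1 by rewrite mulSn addnA ltn_add2r.
  by move/leq_trans; apply; rewrite leq_add2l leq_mul2r ltn_ord orbT.
- move=> i'; have := f'_lt i'; case: (ltnP q t) => [->//|tq].
  by rewrite (_ : (q + i * d.+1 < t) = false) // ltnNge (leq_trans tq) ?leq_addr.
exists y => i'; have := yP i'.
by rewrite /cell -/(tau i q) gE // eE.
Qed.

(** Enlarging the cells one by one until R of them are enlarged, the others being
dropped at the end. *)
Lemma level_bump (i0 : 'I_K) h : 0 < h i0 < K -> level h -> level (bump i0 h).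
Proof.
move=> hi0 lh R.
have mix t : forall d, exists sigma, injective sigma /\ mixed i0 h t d sigma.
  elim: t => [d|t IH]; last exact: mixedS.
  by have [sigma [sinj gs]] := lh d; exists sigma.
have [sigma [sinj gs]] := mix R 0; exists sigma; split=> //.
have gF : Filter gen by exact: generic_filter.
apply: filterS gs => g [x xP]; exists x => q qR.
by have := xP q; rewrite addn0 qR; apply.
Qed.

(** A box with one column per row has a single path, and the paths of a are
consistent. *)
Lemma level1 : level (fun=> 1).
Proof.
move=> R; exists id; split=> //.
have gF : Filter gen by exact: generic_filter.
apply: filterE => g.
pose D := (\max_(v : 'I_R * 'I_K) row v.1 v.2).+1.
have [x [y xyP]] := a_paths (fun r => column g r 0) D.
exists x => q qR f f1; exists y => i.
have fi : f i = 0 :> nat by have := f1 i; rewrite ltnS leqn0 => /eqP.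
rewrite /cell fi; apply: xyP; rewrite ltnS.
exact: (@leq_bigmax _ (fun v : 'I_R * 'I_K => row v.1 v.2) (Ordinal qR, i)).
Qed.

Lemma level_all h : (forall i, 0 < h i <= K) -> level h.
Proof.
have [n] := ubnP (\sum_i h i); elim: n h => // n IH h; rewrite ltnS => hn hK.
have [[i0 hi0]|h1] := pselect (exists i0, 1 < h i0); last first.
  rewrite (_ : h = fun=> 1); first exact: level1.
  apply: funext => i; apply/eqP; rewrite eqn_leq; case/andP: (hK i) => -> _.
  by rewrite leqNgt andbT; apply/negP => ?; apply: h1; exists i.
pose h' i := h i - (i == i0).
have -> : h = bump i0 h'.
  apply: funext => i; rewrite /bump /h' subnK //.
  by case: eqP => // ->; apply: ltnW.
apply: level_bump.
  rewrite /h' eqxx subn_gt0 hi0 /=; case/andP: (hK i0) => h0 hiK.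
  by rewrite subn1 prednK.
apply: IH => [|i].
  apply: leq_trans hn; rewrite (bigD1 i0) //= [X in _ < X](bigD1 i0) //=.
  rewrite -addSn leq_add //.
    by rewrite /h' eqxx subn1 prednK // ltnW.
  by apply: leq_sum => i _; apply: leq_subr.
case/andP: (hK i) => h0 hiK; rewrite (leq_trans (leq_subr _ _)) // andbT.
by rewrite /h'; case: eqP => [->|_]; rewrite ?subn0 ?subn_gt0.
Qed.

(** One cell of the full shape K by K, with its generic columns replaced by honest
ones: row i of the box is the row r i of a, with the columns c i j for j < K. *)
Lemma exists_compatible_box :
  exists (x : 'I_1 -> M) (r : 'I_K -> nat) (c : 'I_K -> nat -> nat),
  (forall i, {in gtn K &, injective (c i)}) /\
  forall f : {ffun 'I_K -> 'I_K}, exists y, forall i, Phi x y (a (r i) (c i (f i))).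
Proof.
have [|sigma [_ gs]] := level_all (h := fun=> K) _ 1; first by rewrite K_gt0 leqnn.
pose m0 := (\max_i row (sigma 0) i).+1.
have row_m0 i : row (sigma 0) i < m0 by rewrite ltnS leq_bigmax.
have [b [binj bP]] := generic_extract U_proper U_free K_gt0 m0 K gs.
have [||g [x xP] gE] := bP (fun _ s => s) => //.
  by move=> r s s' /andP[].
exists x, (row (sigma 0)), (fun i => b (row (sigma 0) i)); split=> [i|f].
  exact: binj.
have [|y yP] := xP 0 isT f; first by move=> i; exact: ltn_ord.
by exists y => i; have := yP i; rewrite /cell gE.
Qed.
End Core.

(** * Reduction of the number of variables *)

Lemma TP2_incons (L : language) (M : structure L) (n m : nat)
    (phi : formula L ('I_n + 'I_m)) (b c : 'I_m -> M) :
  ~ consistent [set inst phi b; inst phi c] ->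
  ~ exists x, sat (sum_env x b) phi /\ sat (sum_env x c) phi.
Proof.
move=> incons [x [xb xc]]; apply: incons => q qbc _; exists x => psi /qbc.
by case=> ->; apply/sat_param_inst.
Qed.

Lemma TP2_cons (L : language) (M : structure L) (n m : nat)
    (phi : formula L ('I_n + 'I_m)) (a : nat -> 'I_m -> M) (D : nat) :
  consistent [set inst phi (a alpha) | alpha in [set: nat]] ->
  exists x, forall alpha, alpha < D -> sat (sum_env x (a alpha)) phi.
Proof.
move=> cons; have [||x xP] := cons [set inst phi (a alpha) | alpha in `I_D].
- by move=> _ [alpha _ <-]; exists alpha.
- exact: finite_image (finite_II D).
by exists x => alpha alphaD; apply/sat_param_inst/xP; exists alpha.
Qed.

Definition join (A : Type) (n : nat) (x : 'I_1 -> A) (y : 'I_n -> A)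
  (i : 'I_(1 + n)) : A := match fintype.split i with inl j => x j | inr j => y j end.

Section Reduction.
Variables (L : language) (M : structure L) (K : Type).
Hypothesis K_big : smaller K [set: nat + (func L + rel_sym L)].
Hypothesis M_sat : saturated K M.
Hypothesis no_TP2_1 : ~ exists (m : nat) (phi : formula L ('I_1 + 'I_m)),
  formula_TP2 M phi.

(** The single variable x split off becomes a parameter: a K by K box compatible
with one value of x is a pattern for the relation in y with parameters x z. *)
Lemma TP2_drop_variable (n m : nat) (phi : formula L ('I_(1 + n) + 'I_m)) :
  formula_TP2 M phi ->
  exists (m' : nat) (phi' : formula L ('I_n + 'I_m')), formula_TP2 M phi'.
Proof.
move=> [a [incons cons]].
pose Phi (x : 'I_1 -> M) (y : 'I_n -> M) (z : 'I_m -> M) :=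
  sat (sum_env (join x y) z) phi.
have Phi_def : definable (fun e : ('I_1 + 'I_m) + 'I_n -> M =>
    Phi (e \o inl \o inl) (e \o inr) (e \o inl \o inr)).
  exists (rename (fun v : 'I_(1 + n) + 'I_m => match v with
    | inl i => match fintype.split i with inl j => inl (inl j) | inr j => inr j end
    | inr k => inl (inr k) end) phi) => e.
  rewrite sat_rename /Phi (_ : _ \o _ = sum_env
    (join (e \o inl \o inl) (e \o inr)) (e \o inl \o inr)) //.
  by apply: funext => -[i|//] /=; rewrite /join; case: (fintype.split i).
have paths (f : nat -> nat) D : exists x y, forall alpha, alpha < D ->
    Phi x y (a alpha (f alpha)).
  have [x xP] := TP2_cons D (cons f).
  exists (x \o lshift n), (x \o @rshift 1 n) => alpha /xP.
  rewrite /Phi (_ : join _ _ = x) //; apply: funext => i; rewrite /join.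
  by rewrite -[in RHS](splitK i); case: (fintype.split i).
have no_pattern1 (I : finType) (E : ('I_1 -> M) -> (I -> M) -> Prop) :
    definable_rel E ->
    exists R, forall w : 'I_R -> 'I_R -> I -> M, ~ pattern E w.
  move=> dE; apply: contrapT => pat; apply: no_TP2_1.
  apply: (TP2_of_patterns K_big M_sat dE) => R.
  by apply: contrapT => noR; apply: pat; exists R => w Ew; apply: noR; exists w.
have Psi_def : definable_rel (fun (y : 'I_n -> M) (v : 'I_1 + 'I_m -> M) =>
    Phi (v \o inl) y (v \o inr)).
  exact: (definable_rename (fun v : ('I_1 + 'I_m) + 'I_n =>
    match v with inl v => inr v | inr i => inl i end) Phi_def).
apply: (TP2_of_patterns K_big M_sat Psi_def) => -[|R].
  have [d] := carrier_inhabited M; exists (fun _ _ _ => d); split=> [[]//|f].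
  by exists (fun=> d) => -[].
have [U [U_proper U_dec U_free]] := free_ultrafilter.
have [x [r [c [c_inj xrc]]]] :=
  exists_compatible_box Phi_def paths no_pattern1 U_proper U_dec U_free (ltn0Sn R).
exists (fun alpha i => sum_env x (a (r alpha) (c alpha i))); split.
  move=> alpha i j ij [y [yi yj]].
  have cij : c alpha i <> c alpha j.
    move=> /c_inj; rewrite !inE !ltn_ord => /(_ isT isT) ijE.
    by rewrite ijE ltnn in ij.
  by apply: (TP2_incons (incons (r alpha) _ _ cij)); exists (join x y).
move=> f; have [y yP] := xrc f; exists y => alpha; exact: yP.
Qed.

(** With no variable left there is only one empty tuple, so that any two
consistent instances are jointly consistent and TP2 is impossible. *)
Lemma no_TP2 (n m : nat) (phi : formula L ('I_n + 'I_m)) : ~ formula_TP2 M phi.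
Proof.
elim: n m phi => [|[|n] IH] m phi.
- move=> [a [incons cons]].
  have [x xP] := TP2_cons 1 (cons (fun=> 0)).
  have [y yP] := TP2_cons 1 (cons (fun=> 1)).
  apply: (@TP2_incons _ _ _ _ _ _ _ (incons 0 0 1 _)) => //; exists x.
  rewrite [X in _ /\ sat (sum_env X _) _](_ : x = y); last by apply: funext => -[].
  by split; [apply: (xP 0)|apply: (yP 0)].
- by move=> tp2; apply: no_TP2_1; exists m, phi.
by move=> /TP2_drop_variable[m' [phi' /IH]].
Qed.
End Reduction.

Theorem mainTheorem4 (L : language) (T : set (sentence L))
  (hT : complete_theory T)
  (M : structure L) (hM : monster_model T M)
  (hTP2 : theory_TP2 M) :
  exists (m : nat) (phi : formula L ('I_1 + 'I_m)), formula_TP2 M phi.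
Proof.
have [_ [K [K_big M_sat _]]] := hM; have [n [m [phi tp2]]] := hTP2.
apply: contrapT => no1; exact: (no_TP2 K_big M_sat no1 tp2).
Qed.
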